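(* Let $n\ge1$ be an integer, let $p\in\mathbf{Q}$ with $p\ge1$, and let $\ell=n$ if $p\neq1$ and $\ell=n-1$ if $p=1$. Let $P_c^{+}$ be the transition probability matrix of the $(+b,n,p)$-carries process, where $b=pc+1\in\mathbf{N}$ with $c\in\mathbf{N}$, and let $P_c^{-}$ be the transition probability matrix of the $(-b,n,p)$-carries process, where $b=pc-1\in\mathbf{N}$ with $c\in\mathbf{N}$. Then, in each of the two cases, $$(P_c^{\pm})^N=\sum_{k=0}^{\ell}(\pm b)^{-kN}E_k,\qquad N=0,1,2,\dots,$$ where $E_k$ is the projection matrix given by $$E_k=|\mathbf{u}_k\rangle\langle\mathbf{v}_k|,\qquad\text{that is,}\qquad (E_k)_{ij}=u_{ik}\,v_{kj}\quad(0\le i,j\le\ell).$$ Therefore $P_c^{\pm}$ is diagonalizable and its eigenvalues are $\{(\pm b)^{-k}\}_{k=0}^{\ell}$, with right and left eigenvectors for $(\pm b)^{-k}$ being $\mathbf{u}_k$ and $\mathbf{v}_k$ respectively, for both processes.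
   Context: $\mathbf{N}$ denotes the positive integers, and $p^*$ is defined by $\frac1p+\frac1{p^*}=1$ (so $1/p^*=1-1/p$). Put $\mathcal{C}(p)=\{0,1,\dots,\ell\}$ and $\mathcal{D}(b)=\{0,1,\dots,b-1\}$. The processes are Markov chains on $\mathcal{C}(p)$ defined as follows. $(+b,n,p)$-carries process ($b=pc+1$): given $C^+_k\in\mathcal{C}(p)$, choose $X_1,\dots,X_n\in\mathcal{D}(b)$ independently and uniformly at random; then $C^+_{k+1}\in\mathcal{C}(p)$ is determined by $$C^+_k+X_1+\cdots+X_n+\frac{b-1}{p^*}=C^+_{k+1}\,b+r,\qquad r\in\mathcal{D}(b).$$ $(-b,n,p)$-carries process ($b=pc-1$): given $C^-_k\in\mathcal{C}(p)$, choose $X_1,\dots,X_n\in\mathcal{D}(b)$ independently and uniformly at random; then $C^-_{k+1}\in\mathcal{C}(p)$ is determined by $$C^-_k+X_1+\cdots+X_n+\frac{b+1}{p}-1=(n-C^-_{k+1})\,b+r,\qquad r\in\mathcal{D}(b).$$ The transition matrix is $P_c^{\pm}=(P_c^{\pm}(i,j))_{i,j=0,\dots,\ell}$ with $P_c^{\pm}(i,j)=P(C^{\pm}_{k+1}=j\mid C^{\pm}_k=i)$. Writing $[x^m]f$ for the coefficient of $x^m$ in a power series (or polynomial) $f$, define $(\ell+1)\times(\ell+1)$ matrices $V=(v_{ij})_{i,j=0,\dots,\ell}$ and $U=(u_{ij})_{i,j=0,\dots,\ell}$ by $$v_{ij}=[x^j]\Bigl((1-x)^{n+1}A_{n-i}(x)\Bigr),\qquad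 A_m(x)=\sum_{k=0}^{\infty}(pk+1)^m x^k,$$ $$u_{ij}=[x^{n-j}]\binom{n+\frac{x-1}{p}-i}{n},$$ where $\binom{y}{n}=y(y-1)\cdots(y-n+1)/n!$. Let $\mathbf{u}_k$ be the $k$-th column of $U$ and $\mathbf{v}_k$ the $k$-th row of $V$, $k=0,\dots,\ell$. *)

(* Defs.v *)
From mathcomp Require Import all_boot all_order all_algebra.

Set Implicit Arguments.
Unset Strict Implicit.
Unset Printing Implicit Defensive.

Import Order.TTheory GRing.Theory Num.Theory.
Local Open Scope ring_scope.

(* The state space {0, ..., ell} of both processes is 'I_(ell n p).+1. *)
Definition ell (n : nat) (p : rat) : nat := if p == 1 then n.-1 else n.

(* 1 / p^*, where 1 / p + 1 / p^* = 1; it is 0 for p = 1, where p^* is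
   infinite. *)
Definition inv_conj (p : rat) : rat := 1 - p^-1.

(* Probability of an event E on the digits (X_1, ..., X_n) when these are
   independent and uniform on {0, ..., b-1}: the sum over the outcomes in E of
   the product of the marginal weights. *)
Definition digit_prob (n b : nat) (E : pred {ffun 'I_n -> 'I_b}) : rat :=
  \sum_(X : {ffun 'I_n -> 'I_b} | E X) \prod_(m < n) b%:R^-1.

(* The digits X lead from the carry i to the carry j.  The equations are stated
   in rat, so that no truncated subtraction or division occurs; when
   b = p * c + 1 (resp. b = p * c - 1) all their terms are integers. *)
Definition plus_step (n b : nat) (p : rat) (i j : nat)
    (X : {ffun 'I_n -> 'I_b}) : bool :=
  [exists r : 'I_b,
    i%:R + \sum_(m < n) (X m)%:R + (b%:R - 1) * inv_conj p
      == j%:R * b%:R + r%:R :> rat].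

Definition minus_step (n b : nat) (p : rat) (i j : nat)
    (X : {ffun 'I_n -> 'I_b}) : bool :=
  [exists r : 'I_b,
    i%:R + \sum_(m < n) (X m)%:R + (b%:R + 1) / p - 1
      == (n%:R - j%:R) * b%:R + r%:R :> rat].

Definition P_plus (n b : nat) (p : rat) : 'M[rat]_((ell n p).+1) :=
  \matrix_(i, j) digit_prob (@plus_step n b p i j).

Definition P_minus (n b : nat) (p : rat) : 'M[rat]_((ell n p).+1) :=
  \matrix_(i, j) digit_prob (@minus_step n b p i j).

(* Power series are represented by their coefficient sequences nat -> rat;
   the product is the Cauchy product. *)
Definition series_mul (f g : nat -> rat) : nat -> rat :=
  fun m => \sum_(k < m.+1) f k * g (m - k)%N.

Definition A_series (p : rat) (m : nat) : nat -> rat :=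
  fun k => (p * k%:R + 1) ^+ m.

Definition V_mx (n : nat) (p : rat) : 'M[rat]_((ell n p).+1) :=
  \matrix_(i, j)
    series_mul (fun k => ((1 - 'X) ^+ n.+1 : {poly rat})`_k)
               (A_series p (n - i)) j.

(* The binomial coefficient y (y - 1) ... (y - n + 1) / n! of a polynomial y. *)
Definition poly_binom (y : {poly rat}) (n : nat) : {poly rat} :=
  (n`!%:R)^-1 *: \prod_(k < n) (y - k%:R).

Definition U_mx (n : nat) (p : rat) : 'M[rat]_((ell n p).+1) :=
  \matrix_(i, j)
    (poly_binom (n%:R + p^-1 *: ('X - 1) - i%:R) n)`_(n - j).

(* The outer product |u_k><v_k|, with entries u_(i,k) * v_(k,j). *)
Definition E_mx (n : nat) (p : rat) (k : 'I_(ell n p).+1) :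
    'M[rat]_((ell n p).+1) :=
  col k (U_mx n p) *m row k (V_mx n p).

(* Main.v *)
Require Import Defs.
From mathcomp Require Import all_boot all_order all_algebra.
From mathcomp Require Import zify ring lra.

Import Order.TTheory GRing.Theory Num.Theory.
Local Open Scope ring_scope.

(** Both carries processes are diagonalized by one family of polynomials,
    w_i(x) = 'C(n + (x - 1) / p - i, n), 0 <= i <= ell, whose coefficients fill
    the rows of U: u_ij is the coefficient of x^(n - j) in w_i.  Two facts
    about this family give everything.

    First, the transition matrix acts on it by scaling the variable: with
    beta = b for the plus process and beta = - b for the minus process,
      sum_j P(i, j) w_j(x) = beta^(-n) w_i(beta x).
    Comparing coefficients of x^(n - k) yields P u_k = beta^(-k) u_k.  It is
    enough to test this at x = p t + 1 for large integers t, where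
    w_j(x) = 'C(n + t - j, n).  The next carry is an integer quotient by b of
    an affine function of X_1 + ... + X_n, so the left side is an average of
    binomial coefficients of such quotients, and it is evaluated by
      sum_X 'C(floor((m + n b - X_1 - ... - X_n) / b), n) = 'C(n + m, n),
    which is [sum_digits_binomial].  Because p (t b + c) + 1 = b (p t + 1) when
    b = p c + 1, the value obtained is w_i at b x; in the minus case it is
    w_i at - b x, through the reflection of the binomial coefficient
    y |-> n - 1 - y ([gbinom_reflect]) and the complement X |-> b - 1 - X of
    the digits.

    Second, a Worpitzky identity: sum_l v_kl w_l(x) = x^(n - k).  At the
    points x = p t + 1 it says that multiplication by (1 - x)^(n + 1) and
    by its inverse series sum_t 'C(n + t, n) x^t cancel.  Reading off
    coefficients gives V U = 1.

    Hence P = U D V with D diagonal and V = U^-1, and all the assertions are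
    linear algebra that tolerates coinciding eigenvalues, as they occur in the
    minus process with b = 1, where beta = - 1. *)

(** * Sums over digit strings *)

Definition digit_sum {n b : nat} (X : {ffun 'I_n -> 'I_b}) : nat :=
  (\sum_(m < n) X m)%N.

(** Stated without subtraction, this is the bound n (b - 1) on the digit sum;
    it keeps every truncated subtraction below exact. *)
Lemma digit_sum_ub {n b} (X : {ffun 'I_n -> 'I_b}) :
  (digit_sum X + n <= n * b)%N.
Proof.
have -> : (n * b = \sum_(m < n) b)%N by rewrite sum_nat_const card_ord.
have -> : (digit_sum X + n = digit_sum X + \sum_(m < n) 1)%N.
  by rewrite sum1_card card_ord.
by rewrite -big_split; apply: leq_sum => m _ /=; rewrite addn1.
Qed.

Lemma sum_digitsS n b (f : nat -> nat) :
  (\sum_(X : {ffun 'I_n.+1 -> 'I_b}) f (digit_sum X)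
   = \sum_(x < b) \sum_(X : {ffun 'I_n -> 'I_b}) f (x + digit_sum X))%N.
Proof.
rewrite pair_big /=.
pose cons_digit (xX : 'I_b * {ffun 'I_n -> 'I_b}) : {ffun 'I_n.+1 -> 'I_b} :=
  [ffun m => if unlift ord0 m is Some m' then xX.2 m' else xX.1].
pose uncons (X : {ffun 'I_n.+1 -> 'I_b}) : 'I_b * {ffun 'I_n -> 'I_b} :=
  (X ord0, [ffun m => X (lift ord0 m)]).
rewrite (reindex cons_digit) /=; last first.
  exists uncons => [[x X] _|X _].
    rewrite /uncons /cons_digit ffunE unlift_none; congr pair.
    by apply/ffunP => m; rewrite !ffunE liftK.
  apply/ffunP => m; rewrite !ffunE.
  by case: unliftP => [j|] -> //; rewrite ffunE.
apply: eq_bigr => -[x X] _; congr f.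
rewrite /digit_sum big_ord_recl /cons_digit ffunE unlift_none; congr addn.
by apply: eq_bigr => m _; rewrite ffunE liftK.
Qed.

(** By induction on [n].  Summing over the first digit alone makes the left
    side for n + 1 a sum of b consecutive values of a function H, so its
    increment in m telescopes to H(m + 1 + b) - H(m + 1); by Pascal's rule this
    is the left side for n, hence 'C(n + m + 1, n), which is also the
    increment of the right side. *)
Lemma sum_digits_binomial n b m : (0 < b)%N ->
  (\sum_(X : {ffun 'I_n -> 'I_b}) 'C((m + n * b - digit_sum X) %/ b, n)
   = 'C(n + m, n))%N.
Proof.
move=> b_gt0; elim: n m => [|n IHn] m.
  under eq_bigr => X _ do rewrite bin0.
  by rewrite bin0 sum1_card card_ffun !card_ord expn0.
pose H s := (\sum_(X : {ffun 'I_n -> 'I_b})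
               'C((s + n * b - digit_sum X) %/ b, n.+1))%N.
have Hb s : H (s + b)%N = (H s + 'C(n + s, n))%N.
  rewrite -IHn -big_split; apply: eq_bigr => X _ /=.
  have leX := digit_sum_ub X.
  have -> : (s + b + n * b - digit_sum X = 1 * b + (s + n * b - digit_sum X))%N.
    by lia.
  by rewrite divnMDl // add1n binS.
(* All quotients are then at most n. *)
have H0 s : (s < b)%N -> H s = 0%N.
  move=> lt_sb; rewrite /H big1 // => X _; apply: bin_small.
  by rewrite ltn_divLR //; lia.
(* The first digit x corresponds to y = b - 1 - x. *)
have LS s : (\sum_(X : {ffun 'I_n.+1 -> 'I_b})
               'C((s + n.+1 * b - digit_sum X) %/ b, n.+1)
             = \sum_(y < b) H (s + y.+1))%N.
  rewrite (sum_digitsS n b (fun d => 'C((s + n.+1 * b - d) %/ b, n.+1))).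
  rewrite (reindex_inj rev_ord_inj) /=; apply: eq_bigr => y _.
  apply: eq_bigr => X _; congr ('C(_ %/ _, _)).
  by have := ltn_ord y; have := digit_sum_ub X; lia.
rewrite LS; elim: m {LS} => [|m IHm].
  case: b b_gt0 {IHn} @H Hb H0 => // b _ H Hb H0.
  rewrite big_ord_recr big1 /= => [|y _]; last by rewrite H0 // add0n ltnS.
  by rewrite Hb H0 // !addn0 !binn.
case: b b_gt0 {IHn} @H Hb H0 IHm => // b _ H Hb H0 IHm.
rewrite big_ord_recl in IHm; rewrite big_ord_recr /= Hb addnA.
rewrite (eq_bigr (fun i : 'I_b => H (m + (lift ord0 i).+1)%N)) => [|i _].
  2: by congr H; rewrite lift0; lia.
rewrite [(\sum_(i < b) _ + _)%N]addnC -[m.+1]addn1 IHm.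
by rewrite addn1 !addnS -addSn binS.
Qed.

(** When the next state is a function [J] of the digits, a row of the
    transition matrix acts on [g] as the average of g (J X) over the digits. *)
Lemma digit_expectation {n b L} (E : 'I_L -> pred {ffun 'I_n -> 'I_b})
    (J : {ffun 'I_n -> 'I_b} -> nat) (g : nat -> rat) :
    (forall X, (J X < L)%N) -> (forall j X, E j X = (J X == j)) ->
  \sum_(j < L) digit_prob (E j) * g j = b%:R ^- n * \sum_X g (J X).
Proof.
move=> ltJ E_J; rewrite mulr_sumr.
under eq_bigr => j _ do rewrite /digit_prob mulr_suml.
rewrite (exchange_big_dep xpredT) //=; apply: eq_bigr => X _.
rewrite (big_pred1 (Ordinal (ltJ X))) => [|j]; last first.
  by rewrite /= E_J -val_eqE eq_sym.
by rewrite prodr_const card_ord exprVn.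
Qed.

Lemma exists_remainder {b} a j : (0 < b)%N ->
  [exists r : 'I_b, a == j * b + r]%N = (a %/ b == j)%N.
Proof.
move=> b_gt0; apply/existsP/eqP => [[r /eqP ->]|<-].
  by rewrite divnMDl // divn_small ?addn0.
by exists (Ordinal (ltn_pmod a b_gt0)); rewrite /= -divn_eq.
Qed.

(** * The polynomials w_i *)

Definition gbinom (y : rat) (n : nat) : rat :=
  n`!%:R^-1 * \prod_(k < n) (y - k%:R).

Lemma gbinom_nat m n : gbinom m%:R n = 'C(m, n)%:R.
Proof.
have nfact_neq0 : n`!%:R != 0 :> rat by rewrite pnatr_eq0 -lt0n fact_gt0.
apply: (mulfI nfact_neq0); rewrite /gbinom mulVKf // -natrM mulnC bin_ffact.
elim: n {nfact_neq0} => [|n IHn]; first by rewrite big_ord0.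
rewrite big_ord_recr /= IHn ffactnSr natrM.
have [le_nm|lt_mn] := leqP n m; first by rewrite natrB.
by rewrite ffact_small // !mul0r.
Qed.

Lemma gbinom_reflect y n : gbinom (n%:R - 1 - y) n = (-1) ^+ n * gbinom y n.
Proof.
rewrite /gbinom mulrCA; congr (_ * _).
rewrite (reindex_inj rev_ord_inj) /= -[n in (-1) ^+ n]card_ord -prodrN.
apply: eq_bigr => k _; rewrite natrB // -natr1; ring.
Qed.

(** The polynomial w_i; its coefficient of degree n - j is u_ij. *)
Definition carry_poly (n : nat) (p : rat) (i : nat) : {poly rat} :=
  poly_binom (n%:R + p^-1 *: ('X - 1) - i%:R) n.

Lemma horner_carry_poly n p i (x : rat) :
  (carry_poly n p i).[x] = gbinom (n%:R + (x - 1) / p - i%:R) n.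
Proof.
rewrite /carry_poly /poly_binom hornerZ horner_prod; congr (_ * _).
apply: eq_bigr => k _.
by rewrite -!polyC_natr !hornerE /= mulrC.
Qed.

Lemma size_carry_poly n p i : (size (carry_poly n p i) <= n.+1)%N.
Proof.
rewrite /carry_poly /poly_binom (leq_trans (size_scale_leq _ _)) //.
apply: leq_trans (size_poly_prod_leq _ _) _.
rewrite card_ord leq_subLR.
apply: (@leq_trans (\sum_(k < n) 2).+1).
  rewrite ltnS; apply: leq_sum => k _.
  have -> : n%:R + p^-1 *: ('X - 1) - i%:R - k%:R
         = p^-1 *: 'X + (n%:R - p^-1 - i%:R - k%:R)%:P :> {poly rat}.
    by rewrite scalerBr !polyCB !polyC_natr alg_polyC; ring.
  rewrite (leq_trans (size_polyD _ _)) // geq_max.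
  rewrite (leq_trans (size_scale_leq _ _)) ?size_polyX //.
  exact: leq_trans (size_polyC_leq1 _) _.
by rewrite sum_nat_const card_ord; lia.
Qed.

Lemma poly_eq_on (F : idomainType) (s : seq F) (f g : {poly F}) :
    uniq s -> (size f <= size s)%N -> (size g <= size s)%N ->
    {in s, forall x, f.[x] = g.[x]} -> f = g.
Proof.
move=> s_uniq sf sg fg; apply/eqP; rewrite -subr_eq0; apply: contraT => nz.
have := max_poly_roots nz _ s_uniq; rewrite ltnNge.
rewrite (leq_trans (size_polyD _ _)) ?size_polyN ?geq_max ?sf //.
by apply; apply/allP => x /fg eq_x; rewrite /root !hornerE eq_x subrr.
Qed.

(** The abscissae p t + 1, t0 <= t < t0 + L, at which w_i takes the integer
    values 'C(n + t - i, n). *)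
Definition samples (p : rat) (t0 L : nat) : seq rat :=
  [seq p * t%:R + 1 | t <- iota t0 L].

Lemma samples_uniq p t0 L : p != 0 -> uniq (samples p t0 L).
Proof.
move=> p_neq0; rewrite map_inj_uniq ?iota_uniq // => s t /addIr /(mulfI p_neq0).
by move/eqP; rewrite eqr_nat => /eqP.
Qed.

Lemma carry_poly_nat n p i t : p != 0 -> (i <= n + t)%N ->
  (carry_poly n p i).[p * t%:R + 1] = 'C(n + t - i, n)%:R.
Proof.
move=> p_neq0 le_i; rewrite horner_carry_poly addrK mulrAC mulfV // mul1r.
by rewrite -natrD -natrB // gbinom_nat.
Qed.

(** * The carries as quotients *)

Lemma ell_leq n p : (ell n p <= n)%N.
Proof. by rewrite /ell; case: ifP => _ //; apply: leq_pred. Qed.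

Lemma ell1 n : (0 < n)%N -> (ell n 1).+1 = n.
Proof. by rewrite /ell eqxx; case: n. Qed.

Lemma ell_neq1 n p : p != 1 -> ell n p = n.
Proof. by rewrite /ell => /negbTE ->. Qed.

(** The state space is stable: since (b - 1) / p^* < b the quotient is at most
    n, and for p = 1 the constant term vanishes, which together with i < n
    leaves the numerator below n b. *)
Lemma plus_carry_lt n b c p i (X : {ffun 'I_n -> 'I_b}) :
    (0 < n)%N -> 1 <= p -> (0 < b)%N -> b%:R = p * c%:R + 1 ->
    (i <= ell n p)%N ->
  ((i + (b - 1 - c) + digit_sum X) %/ b < (ell n p).+1)%N.
Proof.
move=> n_gt0 p_ge1 b_gt0 bE le_i; have sumX := digit_sum_ub X.
rewrite ltn_divLR //.
have [p1|p_neq1] := eqVneq p 1.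
  move: bE le_i; rewrite p1 mul1r natr1 => /eqP; rewrite eqr_nat => /eqP bE.
  by have := ell1 n n_gt0; set L := ell n 1 => LE; rewrite LE; lia.
by move: le_i; rewrite ell_neq1 // => le_i; nia.
Qed.

(** The quotient is n minus the next carry.  For p > 1 the constant term
    c - 1 is below b; for p = 1 it equals b, which raises the quotient to at
    least 1 and so keeps the next carry at most n - 1. *)
Lemma minus_carry_bounds n b c p i (X : {ffun 'I_n -> 'I_b}) :
    (0 < n)%N -> 1 <= p -> (0 < b)%N -> (0 < c)%N -> b%:R = p * c%:R - 1 ->
    (i <= ell n p)%N ->
  (n - ell n p <= (i + c.-1 + digit_sum X) %/ b <= n)%N.
Proof.
move=> n_gt0 p_ge1 b_gt0 c_gt0 bE le_i; have sumX := digit_sum_ub X.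
rewrite leq_divRL // -[X in _ && X]ltnS ltn_divLR //.
have [p1|p_neq1] := eqVneq p 1.
  move: bE le_i; rewrite p1 mul1r => bE.
  have {}bE : c = b.+1 by apply/eqP; rewrite -(eqr_nat rat) -natr1 bE subrK.
  by have := ell1 n n_gt0; set L := ell n 1 => LE; nia.
have c_leb : (c <= b)%N.
  rewrite -ltnS -(ltr_nat rat) -[b.+1%:R]natr1 bE subrK.
  by rewrite ltr_pMl ?ltr0n // lt_def p_neq1.
by move: le_i; rewrite ell_neq1 // subnn => le_i; nia.
Qed.

(** The constant (b - 1) / p^* is the integer b - 1 - c. *)
Lemma plus_stepE n b c p i j (X : {ffun 'I_n -> 'I_b}) :
    1 <= p -> (0 < b)%N -> b%:R = p * c%:R + 1 ->
  plus_step p i j X = ((i + (b - 1 - c) + digit_sum X) %/ b == j)%N.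
Proof.
move=> p_ge1 b_gt0 bE; have p_neq0 : p != 0 by lra.
have le_cb : (c <= b - 1)%N.
  rewrite -(ler_nat rat) natrB // bE addrK.
  by rewrite ler_peMl // ler0n.
have shift : (b%:R - 1) * inv_conj p = (b - 1 - c)%:R.
  by rewrite /inv_conj !natrB // bE addrK; field.
rewrite -exists_remainder //; apply: eq_existsb => r.
rewrite shift -natr_sum -!natrD -natrM -natrD eqr_nat.
by rewrite addnAC.
Qed.

(** The constant (b + 1) / p - 1 is the integer c - 1. *)
Lemma minus_stepE n b c p i j (X : {ffun 'I_n -> 'I_b}) :
    1 <= p -> (0 < b)%N -> (0 < c)%N -> b%:R = p * c%:R - 1 -> (j <= n)%N ->
  minus_step p i j X = ((i + c.-1 + digit_sum X) %/ b == n - j)%N.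
Proof.
move=> p_ge1 b_gt0 c_gt0 bE le_jn; have p_neq0 : p != 0 by lra.
have shift : (b%:R + 1) / p = c%:R by rewrite bE subrK mulrAC mulfV // mul1r.
rewrite -exists_remainder //; apply: eq_existsb => r.
rewrite shift -natr_sum -addrA -[c in c%:R - 1]prednK // -natr1 addrK.
rewrite -!natrD -natrB // -natrM -natrD eqr_nat.
by rewrite addnAC.
Qed.

(** * Action of the transition matrices on the w_i *)

(** A negated floor is a ceiling, and a ceiling is the floor after adding
    b - 1. *)
Lemma subn_divn b k z : (0 < b)%N -> (z %/ b <= k)%N ->
  (k - z %/ b = (k * b + b.-1 - z) %/ b)%N.
Proof.
move=> b_gt0; move: (ltn_pmod z b_gt0); rewrite [in (_ - z)%N](divn_eq z b).
move: (z %/ b)%N (z %% b)%N => q r lt_rb le_qk.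
have le_qbkb : (q * b <= k * b)%N by rewrite leq_mul2r le_qk orbT.
have -> : (k * b + b.-1 - (q * b + r) = (k - q) * b + (b.-1 - r))%N.
  by rewrite mulnBl; lia.
by rewrite divnMDl // divn_small ?addn0 //; lia.
Qed.

(** The relation p (t b + c) + 1 = b (p t + 1) turns the value
    'C(n + t b + c - i, n) given by [sum_digits_binomial] into w_i at
    b (p t + 1). *)
Lemma sum_plus_carry_poly n b c p (i : 'I_(ell n p).+1) t :
    (0 < n)%N -> 1 <= p -> (0 < b)%N -> b%:R = p * c%:R + 1 -> (n <= t)%N ->
  \sum_j P_plus n b p i j * (carry_poly n p j).[p * t%:R + 1]
  = b%:R ^- n * (carry_poly n p i).[b%:R * (p * t%:R + 1)].
Proof.
move=> n_gt0 p_ge1 b_gt0 bE le_nt; have p_neq0 : p != 0 by lra.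
have le_in : (i <= n)%N by rewrite (leq_trans (leq_ord i)) ?ell_leq.
have le_cb : (c <= b - 1)%N.
  by rewrite -(ler_nat rat) natrB // bE addrK ler_peMl // ler0n.
have tb : (t <= t * b)%N by rewrite leq_pmulr.
have -> : b%:R * (p * t%:R + 1) = p * (t * b + c)%:R + 1 :> rat.
  by rewrite natrD natrM [in RHS]mulrDr -[RHS]addrA -bE; ring.
rewrite carry_poly_nat //; last by lia.
under eq_bigr => j _ do rewrite mxE carry_poly_nat
  ?(leq_trans (leq_ord j)) ?(leq_trans (ell_leq n p)) ?leq_addr //.
rewrite (digit_expectation _ _ (fun k => 'C(n + t - k, n)%:R)
  (fun X => plus_carry_lt n b c p i X n_gt0 p_ge1 b_gt0 bE (leq_ord i))).
  2: by move=> j X; apply: plus_stepE.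
congr (_ * _); rewrite -natr_sum; congr _%:R.
have -> : (n + (t * b + c) - i = n + (t * b + c - i))%N by lia.
rewrite -(sum_digits_binomial n b) //; apply: eq_bigr => X _.
have sumX := digit_sum_ub X.
have lt_q := plus_carry_lt n b c p i X n_gt0 p_ge1 b_gt0 bE (leq_ord i).
rewrite subn_divn //; last by have := ell_leq n p; lia.
by congr ('C(_ %/ _, _)); lia.
Qed.

(** Complementing the digits reverses the sign of their sum and brings the
    left side to the form of [sum_digits_binomial], with value
    'C(t b + i + c - 1, n).  The sign (-1)^n from reflecting the binomial
    coefficient at - b (p t + 1) is absorbed by (- b)^(-n). *)
Lemma sum_minus_carry_poly n b c p (i : 'I_(ell n p).+1) t :
    (0 < n)%N -> 1 <= p -> (0 < b)%N -> (0 < c)%N -> b%:R = p * c%:R - 1 ->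
    (n <= t)%N ->
  \sum_j P_minus n b p i j * (carry_poly n p j).[p * t%:R + 1]
  = (- b%:R) ^- n * (carry_poly n p i).[- b%:R * (p * t%:R + 1)].
Proof.
move=> n_gt0 p_ge1 b_gt0 c_gt0 bE le_nt; have p_neq0 : p != 0 by lra.
have tb : (t <= t * b)%N by rewrite leq_pmulr.
have -> : (carry_poly n p i).[- b%:R * (p * t%:R + 1)]
          = (-1) ^+ n * 'C(t * b + i + c.-1, n)%:R.
  rewrite horner_carry_poly -gbinom_nat -gbinom_reflect; congr (gbinom _ n).
  rewrite !natrD natrM.
  have -> : c.-1%:R = c%:R - 1 :> rat.
    by rewrite -[in RHS](prednK c_gt0) -natr1 addrK.
  by rewrite bE; field.
rewrite -exprVn invrN mulrA -exprMn mulrN1 opprK exprVn.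
under eq_bigr => j _ do rewrite mxE carry_poly_nat
  ?(leq_trans (leq_ord j)) ?(leq_trans (ell_leq n p)) ?leq_addr //.
have bounds X :=
  minus_carry_bounds n b c p i X n_gt0 p_ge1 b_gt0 c_gt0 bE (leq_ord i).
rewrite (digit_expectation _ (fun X => n - (i + c.-1 + digit_sum X) %/ b)%N
          (fun k => 'C(n + t - k, n)%:R)).
- congr (_ * _); rewrite -natr_sum; congr _%:R.
  have -> : (t * b + i + c.-1 = n + (t * b + i + c.-1 - n))%N by lia.
  rewrite -(sum_digits_binomial n b) //.
  pose complement (X : {ffun 'I_n -> 'I_b}) := [ffun m => rev_ord (X m)].
  have complementK : involutive complement.
    by move=> X; apply/ffunP => m; rewrite !ffunE rev_ordK.
  rewrite (reindex_inj (inv_inj complementK)); apply: eq_bigr => X _.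
  have sum_complement : (digit_sum (complement X) + digit_sum X + n = n * b)%N.
    have -> : (n * b = \sum_(m < n) b)%N by rewrite sum_nat_const card_ord.
    rewrite -[X in (_ + X)%N]card_ord -sum1_card -!big_split.
    apply: eq_bigr => m _; rewrite ffunE /=.
    by have := ltn_ord (X m); move: (nat_of_ord _) => x; lia.
  have /andP[_ le_qn] := bounds (complement X).
  rewrite [(n + t)%N]addnC -addnBA ?leq_subr // subKn // -divnMDl //.
  by congr ('C(_ %/ _, _)); lia.
- by move=> X; have := bounds X; lia.
move=> j X; rewrite (minus_stepE n b c) //; last first.
  by rewrite (leq_trans (leq_ord j)) ?ell_leq.
have := bounds X; have := leq_ord j; have := ell_leq n p.
by move: (_ %/ _)%N => q; lia.
Qed.

(** The sampled identity holds at infinitely many points, so it is an identity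
    of polynomials; the right side is beta^(-n) w_i(beta x), written by
    coefficients. *)
Lemma sum_rows_carry_poly {n p} (P : 'M[rat]_((ell n p).+1)) (beta : rat) :
    p != 0 ->
    (forall (i : 'I_(ell n p).+1) t, (n <= t)%N ->
       \sum_j P i j * (carry_poly n p j).[p * t%:R + 1]
       = beta ^- n * (carry_poly n p i).[beta * (p * t%:R + 1)]) ->
  forall i : 'I_(ell n p).+1,
  \sum_j P i j *: carry_poly n p j
  = beta ^- n *: \poly_(k < n.+1) (beta ^+ k * (carry_poly n p i)`_k).
Proof.
move=> p_neq0 P_eval i; apply: (poly_eq_on _ (samples p n n.+1)).
- exact: samples_uniq.
- rewrite size_map size_iota (leq_trans (size_sum _ _ _)) //.
  apply/bigmax_leqP => j _.
  by rewrite (leq_trans (size_scale_leq _ _)) ?size_carry_poly.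
- by rewrite size_map size_iota (leq_trans (size_scale_leq _ _)) ?size_poly.
move=> _ /mapP[t + ->]; rewrite mem_iota => /andP[le_nt _].
rewrite horner_sum hornerZ horner_poly.
under eq_bigr do rewrite hornerZ.
rewrite P_eval // (horner_coef_wide _ (size_carry_poly n p i)); congr (_ * _).
by apply: eq_bigr => k _; rewrite exprMn [beta ^+ k * _]mulrC mulrA.
Qed.

(** The coefficient of x^(n - k) on both sides of the previous identity;
    beta^(-n) beta^(n - k) = beta^(-k). *)
Lemma mulmx_U {n p} (P : 'M[rat]_((ell n p).+1)) (beta : rat) :
    p != 0 -> beta != 0 ->
    (forall (i : 'I_(ell n p).+1) t, (n <= t)%N ->
       \sum_j P i j * (carry_poly n p j).[p * t%:R + 1]
       = beta ^- n * (carry_poly n p i).[beta * (p * t%:R + 1)]) ->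
  P *m U_mx n p = U_mx n p *m diag_mx (\row_k beta ^- k).
Proof.
move=> p_neq0 beta_neq0 P_eval; apply/matrixP => i k.
have le_kn : (k <= n)%N by rewrite (leq_trans (leq_ord k)) ?ell_leq.
rewrite mul_mx_diag !mxE.
have := congr1 (coefp (n - k)) (sum_rows_carry_poly P beta p_neq0 P_eval i).
rewrite /= coef_sum coefZ coef_poly ltnS leq_subr => P_coef.
transitivity (\sum_j (P i j *: carry_poly n p j)`_(n - k)).
  by apply: eq_bigr => j _; rewrite coefZ mxE.
rewrite P_coef mulrA [RHS]mulrC; congr (_ * _).
by rewrite -{1}(subnK le_kn) exprD invfM mulrAC mulVf ?mul1r ?expf_neq0.
Qed.

(** * Worpitzky's identity and the inverse of U *)

Lemma coef_mulr_truncate (R : nzRingType) (f g h : {poly R}) m :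
  (forall s, (s <= m)%N -> g`_s = h`_s) -> (f * g)`_m = (f * h)`_m.
Proof.
by move=> eq_gh; rewrite !coefM; apply: eq_bigr => j _; rewrite eq_gh ?leq_subr.
Qed.

(** The series sum_k 'C(n + k, n) x^k is the inverse of (1 - x)^(n + 1); below
    degree T it may be replaced by its truncation.  Each further factor
    1 - x lowers n by one, by Pascal's rule. *)
Lemma coef_expr_1subX_inv (R : nzRingType) n T m : (m < T)%N ->
  ((1 - 'X) ^+ n.+1 * \poly_(k < T) 'C(n + k, n)%:R : {poly R})`_m
  = (m == 0)%:R.
Proof.
elim: n m => [|n IHn] m lt_mT.
  rewrite expr1 mulrBl mul1r coefB coefXM !coef_poly lt_mT.
  case: m lt_mT => [|m] lt_mT; first by rewrite subr0 bin0.
  by rewrite /= (ltnW lt_mT) !bin0 subrr.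
rewrite -(IHn m lt_mT) exprSr -mulrA; apply: coef_mulr_truncate => s le_sm.
have lt_sT := leq_ltn_trans le_sm lt_mT.
rewrite mulrBl mul1r coefB coefXM !coef_poly lt_sT.
case: s lt_sT {le_sm} => [|s] lt_sT; first by rewrite subr0 !addn0 !binn.
by rewrite /= (ltnW lt_sT) addnS binS natrD addrC addKr addSnnS.
Qed.

(** Associativity of the product of (1 - x)^(n + 1), [f] and the inverse series
    of the first factor, carried out on truncations so as to stay with
    polynomials. *)
Lemma series_mul_binomial_inv n (f : nat -> rat) t :
  \sum_(l < t.+1) series_mul (fun k => ((1 - 'X) ^+ n.+1 : {poly rat})`_k) f l
                  * 'C(n + (t - l), n)%:R
  = f t.
Proof.
pose F := \poly_(k < t.+1) f k.
pose B : {poly rat} := \poly_(k < t.+1) 'C(n + k, n)%:R.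
transitivity (((1 - 'X) ^+ n.+1 * F * B)`_t).
  rewrite coefM; apply: eq_bigr => l _.
  rewrite [B`__]coef_poly ltnS leq_subr; congr (_ * _).
  rewrite coefM /series_mul; apply: eq_bigr => k _.
  rewrite coef_poly ltnS (leq_trans (leq_subr _ _)) //; exact: leq_ord.
rewrite [_ * F]mulrC -mulrA.
rewrite (coef_mulr_truncate _ _ _ 1) ?mulr1 ?coef_poly ?ltnSn // => s le_st.
by rewrite coef_expr_1subX_inv // coef1.
Qed.

(** Both sides have degree at most n, so n + 1 points suffice: x = p t + 1 for
    0 <= t <= ell, and also x = 0 when p = 1, as then ell = n - 1. *)
Lemma worpitzky n p (k : 'I_(ell n p).+1) : (0 < n)%N -> p != 0 ->
  \sum_l V_mx n p k l *: carry_poly n p l = 'X^(n - k).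
Proof.
move=> n_gt0 p_neq0.
pose s := (if p == 1 then [:: 0] else [::]) ++ samples p 0 (ell n p).+1.
have size_s : size s = n.+1.
  rewrite size_cat size_map size_iota; have [p1|p_neq1] := eqVneq p 1.
    by rewrite p1 ell1.
  by rewrite ell_neq1.
apply: (poly_eq_on _ s).
- rewrite cat_uniq samples_uniq // andbT.
  have [p1|p_neq1] := eqVneq p 1; last by rewrite has_sym has_nil.
  apply/hasPn => _ /mapP[t _ ->]; rewrite inE p1 mul1r natr1.
  by rewrite pnatr_eq0.
- rewrite size_s (leq_trans (size_sum _ _ _)) //; apply/bigmax_leqP => l _.
  by rewrite (leq_trans (size_scale_leq _ _)) ?size_carry_poly.
- by rewrite size_s size_polyXn ltnS leq_subr.
move=> x; rewrite mem_cat horner_sum hornerXn.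
under eq_bigr do rewrite hornerZ.
case/orP => [|/mapP[t + ->]].
  (* Here k < n kills the right side, and each w_l(0) is a binomial
     coefficient 'C(n - 1 - l, n) = 0. *)
  have [p1|//] := eqVneq p 1; rewrite inE => /eqP ->.
  have LE : (ell n p).+1 = n by rewrite p1 ell1.
  have lt_kn : (k < n)%N by rewrite -[ltnRHS]LE.
  rewrite expr0n subn_eq0 leqNgt lt_kn big1 // => l _.
  have le_l : (l <= n.-1)%N by have := ltn_ord l; rewrite [ltnRHS]LE; lia.
  have inv_p : p^-1 = 1 by rewrite p1 invr1.
  rewrite horner_carry_poly.
  have -> : n%:R + (0 - 1) / p - l%:R = (n.-1 - l)%:R :> rat.
    by rewrite inv_p mulr1 sub0r natrB // -subn1 natrB.
  by rewrite gbinom_nat bin_small ?mulr0 //; lia.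
(* At x = p t + 1 the terms with l > t vanish, and what remains is the
   coefficient of degree t in the product that inverts the definition of V. *)
rewrite mem_iota add0n /= => lt_t.
rewrite -[RHS](series_mul_binomial_inv n (A_series p (n - k)) t).
rewrite (big_ord_widen _
  (fun l => series_mul _ _ l * 'C(n + (t - l), n)%:R) lt_t) [RHS]big_mkcond.
apply: eq_bigr => l _; have := leq_ord l; have := ell_leq n p => le_ell le_l.
rewrite mxE carry_poly_nat //; last by lia.
case: ltnP => [le_lt|lt_tl]; first by rewrite addnBA.
by rewrite bin_small ?mulr0 //; lia.
Qed.

Lemma mulmx_VU n p : (0 < n)%N -> p != 0 -> V_mx n p *m U_mx n p = 1%:M.
Proof.
move=> n_gt0 p_neq0; apply/matrixP => k k'; rewrite !mxE.
have := congr1 (coefp (n - k')) (worpitzky n p k n_gt0 p_neq0).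
rewrite /= coef_sum coefXn => VU_coef.
transitivity (\sum_l (V_mx n p k l *: carry_poly n p l)`_(n - k')).
  by apply: eq_bigr => l _; rewrite coefZ [U_mx _ _ _ _]mxE.
rewrite VU_coef -val_eqE /=; congr (_%:R : rat); congr nat_of_bool.
have := leq_ord k; have := leq_ord k'; have := ell_leq n p.
by move: (nat_of_ord k) (nat_of_ord k') => x y *; apply/eqP/eqP; lia.
Qed.

(** * Diagonalization by a biorthogonal pair of bases *)

Section Diagonalization.

Variables (F : fieldType) (m : nat) (P U V : 'M[F]_m.+1) (d : 'I_m.+1 -> F).
Hypothesis VU : V *m U = 1%:M.
Hypothesis PU : P *m U = U *m diag_mx (\row_k d k).

Let UV : U *m V = 1%:M. Proof. exact: mulmx1C. Qed.

Lemma left_intertwining : V *m P = diag_mx (\row_k d k) *m V.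
Proof.
by rewrite -[V *m P]mulmx1 -UV !mulmxA -(mulmxA V) PU mulmxA VU mul1mx.
Qed.

Lemma col_eigenvector k : P *m col k U = d k *: col k U.
Proof.
rewrite colE mulmxA PU -!colE; apply/matrixP => i j.
by rewrite mul_mx_diag !mxE mulrC.
Qed.

Lemma row_eigenvector k : row k V *m P = d k *: row k V.
Proof.
rewrite -row_mul left_intertwining; apply/matrixP => i j.
by rewrite mul_diag_mx !mxE.
Qed.

Lemma row_mul_col k : row k V *m col k U = 1%:M.
Proof.
rewrite colE mulmxA -row_mul VU -colE; apply/matrixP => i j.
by rewrite !mxE !ord1 !eqxx.
Qed.

Lemma row_eigenvector_neq0 k : row k V != 0.
Proof.
apply/eqP => V0; have := row_mul_col k; rewrite V0 mul0mx.
by move/matrixP/(_ 0 0)/eqP; rewrite !mxE eq_sym oner_eq0.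
Qed.

Lemma col_eigenvector_neq0 k : col k U != 0.
Proof.
apply/eqP => U0; have := row_mul_col k; rewrite U0 mulmx0.
by move/matrixP/(_ 0 0)/eqP; rewrite !mxE eq_sym oner_eq0.
Qed.

Lemma spectral_decomposition N :
  P ^+ N = \sum_k d k ^+ N *: (col k U *m row k V).
Proof.
have sum_proj : \sum_k col k U *m row k V = 1%:M.
  rewrite -UV; apply/matrixP => i j; rewrite summxE mxE; apply: eq_bigr => k _.
  by rewrite !mxE big_ord1 !mxE.
elim: N => [|N IHN].
  by rewrite expr0 -[1]sum_proj; apply: eq_bigr => k _; rewrite expr0 scale1r.
rewrite exprS IHN mulr_sumr; apply: eq_bigr => k _.
rewrite -[LHS]/(P *m (_ *: _)) -scalemxAr mulmxA col_eigenvector -scalemxAl.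
by rewrite scalerA exprSr.
Qed.

Lemma diagonalizable_eigenbasis : diagonalizable P.
Proof.
have V_unit : V \in unitmx by case/mulmx1_unit: VU.
exists V => //; apply/(diagonalizable_forP _ V_unit) => i j ne_ij.
rewrite left_intertwining mulmxK // !mxE.
by rewrite -val_eqE (negbTE ne_ij).
Qed.

(** For a left eigenvector v of P, any nonzero coordinate of v U identifies the
    eigenvalue, even if some of the d_k coincide. *)
Lemma eigenvalueE a : eigenvalue P a <-> exists k, a = d k.
Proof.
split=> [/eigenvalueP[v vP v_neq0]|[k ->]]; last first.
  by apply/eigenvalueP; exists (row k V);
    rewrite ?row_eigenvector ?row_eigenvector_neq0.
have /rV0Pn[k vUk] : v *m U != 0.
  apply: contraNneq v_neq0 => vU0.
  by rewrite -[v]mulmx1 -UV mulmxA vU0 mul0mx.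
exists k; apply: (mulIf vUk).
have := congr1 (fun w : 'rV_m.+1 => (w *m U) 0 k) vP.
by rewrite -mulmxA PU mulmxA mul_mx_diag -scalemxAl !mxE mulrC => ->.
Qed.

End Diagonalization.

(** * The spectral decomposition of the carries processes *)

Theorem theorem3p2 (n : nat) (p : rat) (b c : nat)
    (P : 'M[rat]_((ell n p).+1)) (beta : rat)
    (hn : (1 <= n)%N) (hp : 1 <= p) (hb : (0 < b)%N) (hc : (0 < c)%N)
    (hcase :
      [/\ b%:R = p * c%:R + 1, P = P_plus n b p & beta = b%:R]
      \/ [/\ b%:R = p * c%:R - 1, P = P_minus n b p & beta = - b%:R]) :
  [/\ forall N : nat,
        P ^+ N = \sum_(k < (ell n p).+1) beta ^- (k * N) *: E_mx k,
      forall k : 'I_(ell n p).+1, E_mx k *m E_mx k = E_mx k,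
      diagonalizable P,
      forall (F : numFieldType) (a : F),
        eigenvalue (map_mx ratr P) a
        <-> exists k : 'I_(ell n p).+1, a = ratr (beta ^- k)
    & forall k : 'I_(ell n p).+1,
        [/\ col k (U_mx n p) != 0,
            P *m col k (U_mx n p) = beta ^- k *: col k (U_mx n p),
            row k (V_mx n p) != 0
          & row k (V_mx n p) *m P = beta ^- k *: row k (V_mx n p)]].
Proof.
have p_neq0 : p != 0 by lra.
have b_neq0 : b%:R != 0 :> rat by rewrite pnatr_eq0 -lt0n.
have VU := mulmx_VU n p hn p_neq0.
have PU : P *m U_mx n p = U_mx n p *m diag_mx (\row_k beta ^- k).
  case: hcase => -[bE -> ->]; apply: mulmx_U; rewrite ?oppr_eq0 // => i t le_nt.
    exact: (sum_plus_carry_poly n b c).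
  exact: (sum_minus_carry_poly n b c).
split=> [N|k||F a|k].
- rewrite (spectral_decomposition _ _ _ _ _ _ VU PU).
  by apply: eq_bigr => k _; rewrite exprVn exprM.
- rewrite /E_mx -mulmxA [row _ _ *m (_ *m _)]mulmxA.
  by rewrite (row_mul_col _ _ _ _ VU) mul1mx.
- exact: diagonalizable_eigenbasis VU PU.
- apply: (eigenvalueE _ _ _ (map_mx ratr (U_mx n p)) (map_mx ratr (V_mx n p))).
    by rewrite -map_mxM VU map_mx1.
  rewrite -map_mxM PU map_mxM map_diag_mx; congr (_ *m diag_mx _).
  by apply/matrixP => i j; rewrite !mxE.
split.
- exact: col_eigenvector_neq0 VU _.
- exact: col_eigenvector PU _.
- exact: row_eigenvector_neq0 VU _.
- exact: row_eigenvector VU PU _.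
Qed.
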